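(* Let $B$ be a complex Banach space and let $e^{z\mathbf{A}}$ be a semigroup on $B$ that is analytic $S\to\mathbb{B}(B)$ in the sector $S=\{z\in\mathbb{C}\mid|\arg z|<\theta\}$ for some $\theta>0$. Then $e^{z\mathbf{A}}$ is injective for all $z\in S$.
   Context: $\mathbb{B}(B)$ is the Banach space of bounded linear operators on $B$. $\mathbf{A}$ is the generator of a strongly continuous ($C_0$-)semigroup $e^{t\mathbf{A}}$, $t\ge0$, on $B$. That the semigroup is analytic in the sector $S$ means, as usual, that it extends to a family $e^{z\mathbf{A}}\in\mathbb{B}(B)$, $z\in S$, which is analytic in $z\in S$, satisfies $e^{(z_1+z_2)\mathbf{A}}=e^{z_1\mathbf{A}}e^{z_2\mathbf{A}}$ for $z_1,z_2\in S$, and $e^{0\mathbf{A}}=I$ with $e^{z\mathbf{A}}x\to x$ for $z\to0$ in $S$, for every $x\in B$. *)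

(* Defs.v *)
From Stdlib Require Import Reals Lra FunctionalExtensionality ProofIrrelevance.
From Coquelicot Require Import Coquelicot.
Open Scope R_scope.

Notation C := Complex.C.

Section BoundedOperators.

Context {B : NormedModule C_AbsRing}.

(* Coquelicot's [is_linear] includes boundedness. *)
Record bounded_op := BoundedOp {
  op_fun :> B -> B;
  op_is_linear : is_linear op_fun }.

Lemma bounded_op_ext (S T : bounded_op) : (forall x, S x = T x) -> S = T.
Proof.
destruct S as [f hf], T as [g hg]; simpl; intros H.
assert (E : f = g) by (apply functional_extensionality; exact H).
subst g; f_equal; apply proof_irrelevance.
Qed.

Definition op_id : bounded_op := BoundedOp (fun x => x) is_linear_id.

Definition op_zero : bounded_op := BoundedOp (fun _ => zero) is_linear_zero.

Lemma op_plus_is_linear (S T : bounded_op) :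
  is_linear (fun x => plus (S x) (T x)).
Proof.
exact (is_linear_comp _ _
  (is_linear_prod _ _ (op_is_linear S) (op_is_linear T)) is_linear_plus).
Qed.

Definition op_plus (S T : bounded_op) : bounded_op :=
  BoundedOp _ (op_plus_is_linear S T).

Definition op_opp (T : bounded_op) : bounded_op :=
  BoundedOp _ (is_linear_comp _ _ (op_is_linear T) is_linear_opp).

Definition op_scal (k : C_AbsRing) (T : bounded_op) : bounded_op :=
  BoundedOp _ (is_linear_comp _ _ (op_is_linear T)
                 (is_linear_scal_r k Cmult_comm)).

Definition op_comp (S T : bounded_op) : bounded_op :=
  BoundedOp _ (is_linear_comp _ _ (op_is_linear T) (op_is_linear S)).

Definition op_bound (T : bounded_op) (M : R) : Prop :=
  0 <= M /\ forall x, norm (T x) <= M * norm x.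

Definition op_norm (T : bounded_op) : R := real (Glb_Rbar (op_bound T)).

Lemma op_norm_correct (T : bounded_op) :
  op_bound T (op_norm T) /\ forall M, op_bound T M -> op_norm T <= M.
Proof.
unfold op_norm.
destruct (Glb_Rbar_correct (op_bound T)) as [Hlb Hglb].
destruct (linear_norm _ (op_is_linear T)) as [M0 [HM0 HT0]].
assert (H0 : Rbar_le 0 (Glb_Rbar (op_bound T))).
{ apply Hglb; intros M [HM _]; exact HM. }
assert (H1 : Rbar_le (Glb_Rbar (op_bound T)) M0).
{ apply Hlb; split; [lra | exact HT0]. }
destruct (Glb_Rbar (op_bound T)) as [g | |]; simpl in *; try tauto.
split; [split; [exact H0|] | exact Hlb].
intros x.
destruct (Req_dec (norm x) 0) as [Hx | Hx].
{ apply Rle_trans with (M0 * norm x); [apply HT0 | rewrite Hx; lra]. }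
assert (Hpos : 0 < norm x) by (generalize (norm_ge_0 x); lra).
apply Rmult_le_reg_r with (/ norm x); [apply Rinv_0_lt_compat; lra|].
rewrite Rmult_assoc, Rinv_r, Rmult_1_r by lra.
apply (Hglb (Finite _)); intros M [_ HM]; simpl.
apply Rmult_le_reg_r with (norm x); [lra|].
rewrite Rmult_assoc, Rinv_l, Rmult_1_r by lra.
apply HM.
Qed.

Lemma op_norm_ge_0 (T : bounded_op) : 0 <= op_norm T.
Proof. apply op_norm_correct. Qed.

Lemma op_norm_apply (T : bounded_op) (x : B) :
  norm (T x) <= op_norm T * norm x.
Proof. apply op_norm_correct. Qed.

Lemma op_norm_le (T : bounded_op) (M : R) :
  0 <= M -> (forall x, norm (T x) <= M * norm x) -> op_norm T <= M.
Proof. intros H0 H; apply op_norm_correct; split; assumption. Qed.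

Lemma op_norm_triangle (S T : bounded_op) :
  op_norm (op_plus S T) <= op_norm S + op_norm T.
Proof.
apply op_norm_le.
- generalize (op_norm_ge_0 S) (op_norm_ge_0 T); lra.
- intros x; simpl.
  eapply Rle_trans; [apply norm_triangle|].
  rewrite Rmult_plus_distr_r; apply Rplus_le_compat; apply op_norm_apply.
Qed.

Lemma op_norm_scal (k : C_AbsRing) (T : bounded_op) :
  op_norm (op_scal k T) <= abs k * op_norm T.
Proof.
apply op_norm_le.
- apply Rmult_le_pos; [apply abs_ge_0 | apply op_norm_ge_0].
- intros x; simpl.
  eapply Rle_trans; [apply norm_scal|].
  rewrite Rmult_assoc; apply Rmult_le_compat_l;
    [apply abs_ge_0 | apply op_norm_apply].
Qed.

Lemma op_norm_opp (T : bounded_op) : op_norm (op_opp T) = op_norm T.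
Proof.
apply Rle_antisym; apply op_norm_le; try apply op_norm_ge_0; intros x.
- simpl; rewrite norm_opp; apply op_norm_apply.
- rewrite <- (norm_opp (T x)); exact (op_norm_apply (op_opp T) x).
Qed.

Lemma op_norm_0 (T : bounded_op) : op_norm T = 0 -> T = op_zero.
Proof.
intros H; apply bounded_op_ext; intros x; apply norm_eq_zero.
apply Rle_antisym; [|apply norm_ge_0].
generalize (op_norm_apply T x); rewrite H; lra.
Qed.

Definition bounded_op_AbelianMonoid_mixin :=
  AbelianMonoid.Mixin bounded_op op_plus op_zero
    (fun S T => bounded_op_ext (op_plus S T) (op_plus T S)
       (fun x => plus_comm (S x) (T x)))
    (fun S T U => bounded_op_ext
       (op_plus S (op_plus T U)) (op_plus (op_plus S T) U)
       (fun x => plus_assoc (S x) (T x) (U x)))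
    (fun T => bounded_op_ext (op_plus T op_zero) T
       (fun x => plus_zero_r (T x))).

Canonical bounded_op_AbelianMonoid :=
  AbelianMonoid.Pack bounded_op bounded_op_AbelianMonoid_mixin bounded_op.

Definition bounded_op_AbelianGroup_mixin :=
  AbelianGroup.Mixin bounded_op_AbelianMonoid op_opp
    (fun T => bounded_op_ext (op_plus T (op_opp T)) op_zero
       (fun x => plus_opp_r (T x))).

Canonical bounded_op_AbelianGroup :=
  AbelianGroup.Pack bounded_op
    (AbelianGroup.Class _ _ bounded_op_AbelianGroup_mixin) bounded_op.

Definition bounded_op_ModuleSpace_mixin :=
  ModuleSpace.Mixin C_AbsRing bounded_op_AbelianGroup op_scal
    (fun a b T => bounded_op_ext
       (op_scal a (op_scal b T)) (op_scal (mult a b) T)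
       (fun x => scal_assoc a b (T x)))
    (fun T => bounded_op_ext (op_scal one T) T (fun x => scal_one (T x)))
    (fun a S T => bounded_op_ext
       (op_scal a (op_plus S T)) (op_plus (op_scal a S) (op_scal a T))
       (fun x => scal_distr_l a (S x) (T x)))
    (fun a b T => bounded_op_ext
       (op_scal (plus a b) T) (op_plus (op_scal a T) (op_scal b T))
       (fun x => scal_distr_r a b (T x))).

Canonical bounded_op_ModuleSpace :=
  ModuleSpace.Pack C_AbsRing bounded_op
    (ModuleSpace.Class _ _ _ bounded_op_ModuleSpace_mixin) bounded_op.

Definition op_ball (S : bounded_op) (e : R) (T : bounded_op) : Prop :=
  op_norm (minus T S) < e.

Lemma op_ball_center (T : bounded_op) (e : posreal) : op_ball T e T.
Proof.
unfold op_ball; rewrite minus_eq_zero.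
apply Rle_lt_trans with 0; [|apply cond_pos].
apply op_norm_le; [lra | intros x; simpl; rewrite norm_zero; lra].
Qed.

Lemma op_ball_sym (S T : bounded_op) (e : R) : op_ball S e T -> op_ball T e S.
Proof.
unfold op_ball; rewrite <- (opp_minus T S).
intros H; change (op_norm (op_opp (minus T S)) < e).
now rewrite op_norm_opp.
Qed.

Lemma op_ball_triangle (S T U : bounded_op) (d e : R) :
  op_ball S d T -> op_ball T e U -> op_ball S (d + e) U.
Proof.
unfold op_ball; intros H1 H2.
rewrite (minus_trans T U S).
eapply Rle_lt_trans; [apply op_norm_triangle | lra].
Qed.

Definition bounded_op_UniformSpace_mixin :=
  UniformSpace.Mixin bounded_op op_zero op_ball
    op_ball_center op_ball_sym op_ball_triangle.

Canonical bounded_op_UniformSpace :=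
  UniformSpace.Pack bounded_op bounded_op_UniformSpace_mixin bounded_op.

Canonical bounded_op_NormedModuleAux :=
  NormedModuleAux.Pack C_AbsRing bounded_op
    (NormedModuleAux.Class _ _
       (ModuleSpace.class _ bounded_op_ModuleSpace)
       bounded_op_UniformSpace_mixin) bounded_op.

Definition bounded_op_NormedModule_mixin :
  NormedModule.mixin_of C_AbsRing bounded_op_NormedModuleAux.
Proof.
refine (NormedModule.Mixin C_AbsRing bounded_op_NormedModuleAux op_norm 1
  op_norm_triangle op_norm_scal _ _ op_norm_0).
- intros S T e H; exact H.
- intros S T e H; rewrite Rmult_1_l; exact H.
Defined.

Canonical bounded_op_NormedModule :=
  NormedModule.Pack C_AbsRing bounded_op
    (NormedModule.Class _ _ _ bounded_op_NormedModule_mixin) bounded_op.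

End BoundedOperators.

Arguments bounded_op B : clear implicits.

(* Principal value of the argument, in ]-PI, PI], as a relation. *)
Definition is_arg (z : C) (phi : R) : Prop :=
  - PI < phi <= PI /\ z = (Cmod z * cos phi, Cmod z * sin phi).

(* The argument of 0 is undefined, so the sector does not contain 0. *)
Definition sector (theta : R) (z : C) : Prop :=
  z <> RtoC 0 /\ exists phi, is_arg z phi /\ Rabs phi < theta.

Definition C0_semigroup {B : NormedModule C_AbsRing}
    (U : R -> bounded_op B) : Prop :=
  U 0 = op_id /\
  (forall s t, 0 <= s -> 0 <= t -> U (s + t) = op_comp (U s) (U t)) /\
  (forall x : B, filterlim (fun t => U t x) (at_right 0) (locally x)).

(* The possibly unbounded operator A is represented by its graph:
   [A x y] means that x lies in the domain of A and that A x = y. *)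
Definition is_generator {B : NormedModule C_AbsRing}
    (A : B -> B -> Prop) (U : R -> bounded_op B) : Prop :=
  forall x y : B, A x y <->
    filterlim (fun t : R => scal (RtoC (/ t) : C_AbsRing) (minus (U t x) x))
      (at_right 0) (locally y).

(* Analyticity is complex differentiability with respect to the operator norm.
   If theta > PI / 2 the sector is not stable under addition, and the semigroup
   law is then meaningful only when z1 + z2 remains in the sector. *)
Definition analytic_semigroup {B : NormedModule C_AbsRing}
    (theta : R) (T : C_AbsRing -> bounded_op B) : Prop :=
  (forall z, sector theta z -> ex_derive T z) /\
  (forall z1 z2, sector theta z1 -> sector theta z2 ->
    sector theta (Cplus z1 z2) ->
    T (Cplus z1 z2) = op_comp (T z1) (T z2)) /\
  T (RtoC 0) = op_id /\
  (forall x : B,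
    filterlim (fun z => T z x)
      (within (sector theta) (locally (RtoC 0 : C_AbsRing))) (locally x)).

(* Main.v *)
(* If e^{z0 A} u = 0, then f(z) = e^{zA} u vanishes on z0 + w for w in the sector
   (as long as z0 + w stays in it), in particular near (1 + s) z0 for every
   s > 0. Vanishing propagates from a small disc to any larger concentric disc
   inside the sector, whose radius can be taken a fixed multiple of |z0|; for small s that
   disc contains q z0 with a fixed q < 1. Iterating, f(q^n z0) = 0 for all n,
   and n -> oo gives u = 0.

   The propagation rests on a maximum principle for the norm of a
   vector-valued function g, proved without integrals: if
   g(z + k) + g(z - k) - 2 g(z) = k^2 b + o(k^2), then averaging over
   k = t, -t, i t, -i t cancels the second-order term, so norm g + e |z - c|^2 has
   no interior maximum. For the semigroup this expansion comes for free from
   first-order differentiability at w = z / 2: with P = e^{(w+k)A}, W = e^{wA},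
   N = e^{(w-k)A}, the second difference of e^{zA} is (P - W)(W - N). *)
Require Import Defs.
From Stdlib Require Import Reals Lra Lia List ClassicalEpsilon.
From Coquelicot Require Import Coquelicot.
Open Scope R_scope.

(** * Linear identities between vectors, decided by comparing coefficients *)

Section ModuleNormalization.

Context {V : ModuleSpace C_AbsRing}.

Inductive mexpr :=
  | MVar (i : nat)
  | MZero
  | MPlus (e f : mexpr)
  | MOpp (e : mexpr)
  | MScal (c : C) (e : mexpr).

Fixpoint mdenote (env : list V) (e : mexpr) : V :=
  match e with
  | MVar i => nth i env zero
  | MZero => zero
  | MPlus e f => plus (mdenote env e) (mdenote env f)
  | MOpp e => opp (mdenote env e)
  | MScal c e => scal (c : C_AbsRing) (mdenote env e)
  end.

Fixpoint mcoef (e : mexpr) (i : nat) : C :=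
  match e with
  | MVar j => if Nat.eqb j i then RtoC 1 else RtoC 0
  | MZero => RtoC 0
  | MPlus e f => Cplus (mcoef e i) (mcoef f i)
  | MOpp e => Copp (mcoef e i)
  | MScal c e => Cmult c (mcoef e i)
  end.

Fixpoint mcomb (c : nat -> C) (env : list V) : V :=
  match env with
  | nil => zero
  | cons x l => plus (scal (c O : C_AbsRing) x) (mcomb (fun i => c (S i)) l)
  end.

Lemma mcomb_ext (c d : nat -> C) (env : list V) :
  (forall i, (i < length env)%nat -> c i = d i) -> mcomb c env = mcomb d env.
Proof.
revert c d; induction env as [|x l IH]; intros c d H; simpl; [reflexivity|].
rewrite (H O) by (simpl; lia); f_equal.
apply IH; intros i Hi; apply H; simpl; lia.
Qed.

Lemma mcomb_zero (env : list V) : mcomb (fun _ => RtoC 0) env = zero.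
Proof.
induction env as [|x l IH]; simpl; [reflexivity|].
rewrite IH, plus_zero_r; exact (scal_zero_l x).
Qed.

Lemma mcomb_plus (c d : nat -> C) (env : list V) :
  mcomb (fun i => Cplus (c i) (d i)) env = plus (mcomb c env) (mcomb d env).
Proof.
revert c d; induction env as [|x l IH]; intros c d; simpl.
- now rewrite plus_zero_r.
- rewrite IH.
  rewrite (scal_distr_r (c O : C_AbsRing) (d O) x
    : scal (Cplus (c O) (d O) : C_AbsRing) x = _), <- !plus_assoc; f_equal.
  rewrite !plus_assoc; f_equal; apply plus_comm.
Qed.

Lemma mcomb_scal (a : C) (c : nat -> C) (env : list V) :
  mcomb (fun i => Cmult a (c i)) env = scal (a : C_AbsRing) (mcomb c env).
Proof.
revert c; induction env as [|x l IH]; intros c; simpl.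
- symmetry; exact (scal_zero_r (a : C_AbsRing)).
- now rewrite IH, scal_distr_l, scal_assoc.
Qed.

Lemma mcomb_opp (c : nat -> C) (env : list V) :
  mcomb (fun i => Copp (c i)) env = opp (mcomb c env).
Proof.
rewrite <- (scal_opp_one (mcomb c env)).
etransitivity; [|exact (mcomb_scal (Copp (RtoC 1)) c env)].
apply mcomb_ext; intros i _; ring.
Qed.

Lemma mcomb_var (j : nat) (env : list V) :
  mcomb (fun i => if Nat.eqb j i then RtoC 1 else RtoC 0) env
  = nth j env zero.
Proof.
revert j; induction env as [|x l IH]; intros j; simpl.
- now destruct j.
- destruct j as [|j]; simpl.
  + rewrite mcomb_zero, plus_zero_r; exact (scal_one x).
  + rewrite IH, (scal_zero_l x : scal (RtoC 0 : C_AbsRing) x = zero).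
    apply plus_zero_l.
Qed.

Lemma mdenote_mcomb (env : list V) (e : mexpr) :
  mdenote env e = mcomb (mcoef e) env.
Proof.
induction e as [j| |e IHe f IHf|e IHe|c e IHe]; simpl.
- now rewrite mcomb_var.
- now rewrite mcomb_zero.
- now rewrite mcomb_plus, IHe, IHf.
- now rewrite mcomb_opp, IHe.
- now rewrite mcomb_scal, IHe.
Qed.

(** A recursive conjunction, so that it computes to one explicit equation in [C] per atom, ready for
    [ring] or [field]. *)
Fixpoint mcoef_eq (n : nat) (e f : mexpr) : Prop :=
  match n with
  | O => True
  | S n => mcoef e n = mcoef f n /\ mcoef_eq n e f
  end.

Lemma mcoef_eq_spec (n : nat) (e f : mexpr) :
  mcoef_eq n e f -> forall i, (i < n)%nat -> mcoef e i = mcoef f i.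
Proof.
induction n as [|n IH]; simpl; intros H i Hi; [lia|].
destruct (Nat.eq_dec i n) as [->|Hin]; [apply H | apply IH; [apply H | lia]].
Qed.

Lemma module_eq (env : list V) (e f : mexpr) :
  mcoef_eq (length env) e f -> mdenote env e = mdenote env f.
Proof.
intros H; rewrite !mdenote_mcomb; apply mcomb_ext.
exact (mcoef_eq_spec _ e f H).
Qed.

End ModuleNormalization.

Ltac mindex x l :=
  lazymatch l with
  | cons x _ => constr:(O)
  | cons _ ?l => let i := mindex x l in constr:(S i)
  end.

Ltac madd x l :=
  let rec go m :=
    lazymatch m with
    | nil => constr:(cons x l)
    | cons x _ => l
    | cons _ ?m => go m
    end in
  go l.

Ltac matoms t l :=
  lazymatch t with
  | @plus _ ?a ?b => let l := matoms a l in matoms b l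
  | @minus _ ?a ?b => let l := matoms a l in matoms b l
  | @opp _ ?a => matoms a l
  | @scal _ _ _ ?a => matoms a l
  | @zero _ => l
  | _ => madd t l
  end.

Ltac mreify t l :=
  lazymatch t with
  | @plus _ ?a ?b =>
      let e := mreify a l in let f := mreify b l in constr:(MPlus e f)
  | @minus _ ?a ?b =>
      let e := mreify a l in let f := mreify b l in
      constr:(MPlus e (MOpp f))
  | @opp _ ?a => let e := mreify a l in constr:(MOpp e)
  | @scal _ _ ?c ?a => let e := mreify a l in constr:(MScal c e)
  | @zero _ => constr:(MZero)
  | _ => let i := mindex t l in constr:(MVar i)
  end.

(* Reduces an identity between linear combinations of vectors to the equality
   of the coefficients of each vector. *)
Ltac module_coefs :=
  lazymatch goal with
  | |- @eq ?W ?a ?b =>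
      let l := matoms a (@nil W) in
      let l := matoms b l in
      let e := mreify a l in
      let f := mreify b l in
      refine (module_eq l e f _);
      cbn [mcoef_eq mcoef length Nat.eqb]; repeat split
  end.

Ltac module_ring := module_coefs; ring.


(** * Compactness of closed discs *)

Lemma Cmod_le_Rabs (z : C) : Cmod z <= Rabs (fst z) + Rabs (snd z).
Proof.
destruct z as [x y]; simpl.
replace ((x, y) : C) with (Cplus (RtoC x) (Cmult Ci (RtoC y)))
  by (unfold Ci, RtoC, Cplus, Cmult; simpl; f_equal; ring).
eapply Rle_trans; [apply Cmod_triangle|].
rewrite Cmod_mult, Cmod_Ci, !Cmod_R; lra.
Qed.

Lemma Cmod_minus_sym (z w : C) : Cmod (Cminus z w) = Cmod (Cminus w z).
Proof. rewrite <- Cmod_opp; f_equal; ring. Qed.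

(** The local radii form a gauge on the square around the disc, and compactness of the square yields
    one [e] below enough of them. Since [H e] weakens as [e] shrinks, this [e] serves everywhere. *)
Lemma disc_compact (c : C) (r : R) (H : R -> C -> Prop) :
  (forall d e z, 0 < e <= d -> H d z -> H e z) ->
  (forall z, Cmod (Cminus z c) <= r -> exists d, 0 < d /\
     forall w, Cmod (Cminus w c) <= r -> Cmod (Cminus w z) < d -> H d w) ->
  exists e, 0 < e /\ forall w, Cmod (Cminus w c) <= r -> H e w.
Proof.
intros Hmono Hloc.
(* The gauge must be defined on the whole square: off the disc, a radius too small to reach the disc
   makes the condition vacuous. The factor 2 is there because a box of half-side [d] lies in the
   disc of radius [2 * d]. *)
assert (Hbox : forall p : C, exists d : posreal,
  forall w, Cmod (Cminus w c) <= r -> Cmod (Cminus w p) < 2 * d -> H d w).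
{ intros p; destruct (Rle_lt_dec (Cmod (Cminus p c)) r) as [Hp | Hp].
  - destruct (Hloc p Hp) as [d [Hd Hw]].
    assert (Hd2 : 0 < d / 2) by lra.
    exists (mkposreal _ Hd2); simpl; intros w Hwc Hwp.
    apply Hmono with d; [lra|]; apply Hw; [exact Hwc | lra].
  - assert (Hd2 : 0 < (Cmod (Cminus p c) - r) / 2) by lra.
    exists (mkposreal _ Hd2); simpl; intros w Hwc Hwp; exfalso.
    assert (E : Cminus p c = Cplus (Cminus p w) (Cminus w c)) by ring.
    generalize (Cmod_triangle (Cminus p w) (Cminus w c)).
    rewrite <- E, (Cmod_minus_sym p w); lra. }
set (delta p := proj1_sig (constructive_indefinite_description _ (Hbox p))).
assert (Hdelta : forall p w, Cmod (Cminus w c) <= r ->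
  Cmod (Cminus w p) < 2 * delta p -> H (delta p) w).
{ intros p; exact (proj2_sig (constructive_indefinite_description _ (Hbox p))). }
destruct (compactness_value_2d (fst c - r) (fst c + r) (snd c - r) (snd c + r)
  (fun u v => delta (u, v))) as [d Hd].
exists d; split; [apply cond_pos|].
intros [x y] Hw.
assert (Hx := Rmax_Cmod (Cminus (x, y) c)); simpl in Hx.
assert (Hx1 := Rle_trans _ _ _ (Rmax_l _ _) Hx).
assert (Hx2 := Rle_trans _ _ _ (Rmax_r _ _) Hx).
assert (Hx3 := Rle_trans _ _ _ Hx1 Hw); apply Rabs_le_between in Hx3.
assert (Hx4 := Rle_trans _ _ _ Hx2 Hw); apply Rabs_le_between in Hx4.
apply NNPP; intros Hn; apply (Hd x y); [lra | lra |].
intros [u [v [_ [_ [Hu [Hv Hle]]]]]]; apply Hn.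
apply Hmono with (delta (u, v)); [split; [apply cond_pos | exact Hle]|].
apply Hdelta; [exact Hw|].
eapply Rle_lt_trans; [apply Cmod_le_Rabs|]; simpl.
unfold Rminus in Hu, Hv; lra.
Qed.

(** Compactness is used twice: with [phi z <= / e] it bounds [phi] above; with [phi z <= s - e] it
    shows that a supremum [s] that is not attained could be lowered. *)
Lemma disc_max (c : C) (r : R) (phi : C -> R) :
  0 <= r ->
  (forall z, Cmod (Cminus z c) <= r -> forall e, 0 < e -> exists d, 0 < d /\
     forall w, Cmod (Cminus w z) < d -> Rabs (phi w - phi z) <= e) ->
  exists p, Cmod (Cminus p c) <= r /\
    forall z, Cmod (Cminus z c) <= r -> phi z <= phi p.
Proof.
intros Hr Hcont.
assert (Hc : Cmod (Cminus c c) <= r)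
  by (replace (Cminus c c) with (RtoC 0) by ring; rewrite Cmod_0; exact Hr).
destruct (disc_compact c r (fun e z => phi z <= / e)) as [e [He Hbd]].
{ intros d e z [He Hed] Hd.
  eapply Rle_trans; [exact Hd | apply Rinv_le_contravar; lra]. }
{ intros z Hz; destruct (Hcont z Hz 1 Rlt_0_1) as [d [Hd Hw]].
  set (m := Rmax 1 (phi z + 1)).
  assert (Hm1 : 1 <= m) by apply Rmax_l.
  assert (Hm2 : phi z + 1 <= m) by apply Rmax_r.
  assert (Hm : 0 < / m) by (apply Rinv_0_lt_compat; lra).
  exists (Rmin d (/ m)); split; [apply Rmin_glb_lt; lra|].
  intros w _ Hwz.
  assert (Hmin := Rmin_l d (/ m)).
  assert (Hwz' := Hw w (Rlt_le_trans _ _ _ Hwz Hmin)).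
  apply Rabs_le_between in Hwz'.
  apply Rle_trans with (/ / m); [rewrite Rinv_inv; lra|].
  apply Rinv_le_contravar; [apply Rmin_glb_lt; lra | apply Rmin_r]. }
destruct (completeness (fun y => exists z, Cmod (Cminus z c) <= r /\ y = phi z))
  as [s [Hub Hlub]].
{ exists (/ e); intros y [z [Hz ->]]; exact (Hbd z Hz). }
{ exists (phi c), c; split; [exact Hc | reflexivity]. }
apply NNPP; intros Hno.
assert (Hlt : forall z, Cmod (Cminus z c) <= r -> phi z < s).
{ intros z Hz; apply Rnot_le_lt; intros Hs; apply Hno.
  exists z; split; [exact Hz|]; intros w Hw.
  apply Rle_trans with s; [apply Hub; now exists w | exact Hs]. }
destruct (disc_compact c r (fun e z => phi z <= s - e)) as [e' [He' Hbd']].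
{ intros d e1 z [He1 Hed] Hd; lra. }
{ intros z Hz; assert (Hzs := Hlt z Hz).
  destruct (Hcont z Hz ((s - phi z) / 2)) as [d [Hd Hw]]; [lra|].
  exists (Rmin d ((s - phi z) / 2)); split; [apply Rmin_glb_lt; lra|].
  intros w _ Hwz.
  assert (Hmin := Rmin_l d ((s - phi z) / 2)).
  assert (Hmin' := Rmin_r d ((s - phi z) / 2)).
  assert (Hwz' := Hw w (Rlt_le_trans _ _ _ Hwz Hmin)).
  apply Rabs_le_between in Hwz'; lra. }
assert (s <= s - e'); [|lra].
apply Hlub; intros y [z [Hz ->]]; exact (Hbd' z Hz).
Qed.

(** * Remainders of order [o(k^n)] *)

Section LittleO.

Context {B : NormedModule C_AbsRing}.

Lemma norm_scal_Cmod (k : C) (x : B) :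
  norm (scal (k : C_AbsRing) x) <= Cmod k * norm x.
Proof. exact (norm_scal (k : C_AbsRing) x). Qed.

Lemma norm_minus_le (x y : B) : norm (minus x y) <= norm x + norm y.
Proof. rewrite <- (norm_opp y); apply norm_triangle. Qed.

Definition little_o (n : nat) (rem : C -> B) : Prop :=
  forall e, 0 < e -> exists d, 0 < d /\
    forall k, Cmod k < d -> norm (rem k) <= e * Cmod k ^ n.

Lemma little_o_ext_near (n : nat) (p q : C -> B) (d : R) :
  0 < d -> (forall k, Cmod k < d -> p k = q k) -> little_o n p -> little_o n q.
Proof.
intros Hd E Hp e He; destruct (Hp e He) as [d' [Hd' H]].
exists (Rmin d d'); split; [now apply Rmin_glb_lt|].
intros k Hk; rewrite <- E.
- apply H; eapply Rlt_le_trans; [exact Hk | apply Rmin_r].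
- eapply Rlt_le_trans; [exact Hk | apply Rmin_l].
Qed.

Lemma little_o_plus (n : nat) (p q : C -> B) :
  little_o n p -> little_o n q -> little_o n (fun k => plus (p k) (q k)).
Proof.
intros Hp Hq e He.
destruct (Hp (e / 2)) as [d1 [Hd1 H1]]; [lra|].
destruct (Hq (e / 2)) as [d2 [Hd2 H2]]; [lra|].
exists (Rmin d1 d2); split; [now apply Rmin_glb_lt|].
intros k Hk; eapply Rle_trans; [apply norm_triangle|].
assert (A1 := H1 k (Rlt_le_trans _ _ _ Hk (Rmin_l _ _))).
assert (A2 := H2 k (Rlt_le_trans _ _ _ Hk (Rmin_r _ _))).
lra.
Qed.

End LittleO.

Section SecondOrder.

Context {B : NormedModule C_AbsRing}.

(** The common comparison rule behind scaling by a constant or by [k], evaluation of operators at a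
    vector and application of a bounded operator; for evaluation, [p] and [q] take values in
    different spaces. *)
Lemma little_o_dom {W : NormedModule C_AbsRing} (n m : nat)
    (p : C -> W) (q : C -> B) (M d : R) :
  0 < d -> (forall k, Cmod k < d -> norm (q k) <= M * Cmod k ^ m * norm (p k)) ->
  little_o n p -> little_o (m + n) q.
Proof.
intros Hd Hq Hp e He.
assert (HM : 0 < Rabs M + 1) by (generalize (Rabs_pos M); lra).
destruct (Hp (e / (Rabs M + 1))) as [d' [Hd' H]]; [now apply Rdiv_lt_0_compat|].
exists (Rmin d d'); split; [now apply Rmin_glb_lt|].
intros k Hk.
eapply Rle_trans; [apply Hq; eapply Rlt_le_trans; [exact Hk | apply Rmin_l]|].
assert (A := H k (Rlt_le_trans _ _ _ Hk (Rmin_r _ _))).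
rewrite pow_add.
assert (Hm := pow_le _ m (Cmod_ge_0 k)).
assert (Hn := pow_le _ n (Cmod_ge_0 k)).
assert (HM' : M <= Rabs M + 1) by (generalize (Rle_abs M); lra).
apply Rle_trans with ((Rabs M + 1) * Cmod k ^ m * norm (p k)).
{ apply Rmult_le_compat_r; [apply norm_ge_0|].
  now apply Rmult_le_compat_r. }
apply Rle_trans with
  ((Rabs M + 1) * Cmod k ^ m * (e / (Rabs M + 1) * Cmod k ^ n)).
{ apply Rmult_le_compat_l; [apply Rmult_le_pos; lra | exact A]. }
right; field; lra.
Qed.

Lemma little_o_opp_arg (n : nat) (p : C -> B) :
  little_o n p -> little_o n (fun k => p (Copp k)).
Proof.
intros Hp e He; destruct (Hp e He) as [d [Hd H]].
exists d; split; [exact Hd|]; intros k Hk; rewrite <- (Cmod_opp k).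
apply H; now rewrite Cmod_opp.
Qed.

(** * Second-order expansions and the maximum principle *)

Definition deriv_at (g : C -> B) (z : C) (a : B) : Prop :=
  little_o 1 (fun k =>
    minus (minus (g (Cplus z k)) (g z)) (scal (k : C_AbsRing) a)).

(* For a holomorphic [g], [b] is the second derivative; the symmetric
   difference spares the construction of the first derivative as a function. *)
Definition second_diff_at (g : C -> B) (z : C) (b : B) : Prop :=
  little_o 2 (fun k =>
    minus (minus (plus (g (Cplus z k)) (g (Cminus z k))) (plus (g z) (g z)))
      (scal (Cmult k k : C_AbsRing) b)).

(** The first-order part gives continuity, and it also enters the second-order expansion of a
    quotient by [w - c]. *)
Definition smooth2_at (g : C -> B) (z : C) : Prop :=
  (exists a, deriv_at g z a) /\ exists b, second_diff_at g z b.

Lemma deriv_at_continuous (g : C -> B) (z : C) (a : B) :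
  deriv_at g z a -> forall e, 0 < e -> exists d, 0 < d /\
    forall w, Cmod (Cminus w z) < d -> norm (minus (g w) (g z)) <= e.
Proof.
intros Hg e He; destruct (Hg 1 Rlt_0_1) as [d [Hd H]].
set (m := 1 + norm a).
assert (Hm : 1 <= m) by (unfold m; generalize (norm_ge_0 a); lra).
assert (Hem : 0 < e / m) by (apply Rdiv_lt_0_compat; lra).
exists (Rmin d (e / m)); split; [now apply Rmin_glb_lt|].
intros w Hw; set (k := Cminus w z) in *.
assert (A := H k (Rlt_le_trans _ _ _ Hw (Rmin_l _ _))).
assert (A' := Rlt_le_trans _ _ _ Hw (Rmin_r _ _)).
replace (Cplus z k) with w in A by (unfold k; ring).
replace (minus (g w) (g z)) with
  (plus (minus (minus (g w) (g z)) (scal (k : C_AbsRing) a))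
    (scal (k : C_AbsRing) a)) by module_ring.
eapply Rle_trans; [apply norm_triangle|].
assert (A2 := norm_scal_Cmod k a).
apply Rle_trans with (m * Cmod k); [unfold m; simpl in A; nra|].
apply Rle_trans with (m * (e / m)); [nra | right; field; lra].
Qed.

(** Over the four points at distance [t] from [p], the average of [e * |q - c|^2] exceeds its value
    at [p] by [e * t^2], whereas the remainders cost at most [e * t^2 / 2]. So one of the four
    points beats [p]. *)
Lemma no_interior_max (g : C -> B) (c p : C) (b : B) (e d : R) :
  0 < e -> 0 < d -> second_diff_at g p b ->
  exists q, Cmod (Cminus q p) < d /\
    norm (g p) + e * Cmod (Cminus p c) ^ 2
      < norm (g q) + e * Cmod (Cminus q c) ^ 2.
Proof.
intros He Hd Hg; apply NNPP; intros Hno.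
assert (Hmax : forall q, Cmod (Cminus q p) < d ->
  norm (g q) + e * Cmod (Cminus q c) ^ 2
    <= norm (g p) + e * Cmod (Cminus p c) ^ 2).
{ intros q Hq; apply Rnot_lt_le; intros Hlt; apply Hno; now exists q. }
destruct (Hg e He) as [d' [Hd' Hr]].
set (t := Rmin d d' / 2).
assert (Ht0 : 0 < Rmin d d') by now apply Rmin_glb_lt.
assert (Htd := Rmin_l d d'); assert (Htd' := Rmin_r d d').
assert (Ht : Cmod (RtoC t) = t) by (rewrite Cmod_R, Rabs_pos_eq; unfold t; lra).
assert (Hit : Cmod (Cmult Ci (RtoC t)) = t) by (rewrite Cmod_mult, Cmod_Ci, Ht; ring).
assert (H1 := Hr (RtoC t)); rewrite Ht in H1.
assert (H2 := Hr (Cmult Ci (RtoC t))); rewrite Hit in H2.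
assert (htd : t < d') by (unfold t; lra).
specialize (H1 htd); specialize (H2 htd).
assert (M1 := Hmax (Cplus p (RtoC t))).
assert (M2 := Hmax (Cminus p (RtoC t))).
assert (M3 := Hmax (Cplus p (Cmult Ci (RtoC t)))).
assert (M4 := Hmax (Cminus p (Cmult Ci (RtoC t)))).
replace (Cminus (Cplus p (RtoC t)) p) with (RtoC t) in M1 by ring.
replace (Cminus (Cminus p (RtoC t)) p) with (Copp (RtoC t)) in M2 by ring.
replace (Cminus (Cplus p (Cmult Ci (RtoC t))) p)
  with (Cmult Ci (RtoC t)) in M3 by ring.
replace (Cminus (Cminus p (Cmult Ci (RtoC t))) p)
  with (Copp (Cmult Ci (RtoC t))) in M4 by ring.
rewrite Ht in M1; rewrite Cmod_opp, Ht in M2.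
rewrite Hit in M3; rewrite Cmod_opp, Hit in M4.
assert (htd2 : t < d) by (unfold t; lra).
specialize (M1 htd2); specialize (M2 htd2).
specialize (M3 htd2); specialize (M4 htd2).
rewrite !Cmod2_alt in M1; rewrite !Cmod2_alt in M2.
rewrite !Cmod2_alt in M3; rewrite !Cmod2_alt in M4.
set (g1 := g (Cplus p (RtoC t))) in *.
set (g2 := g (Cminus p (RtoC t))) in *.
set (g3 := g (Cplus p (Cmult Ci (RtoC t)))) in *.
set (g4 := g (Cminus p (Cmult Ci (RtoC t)))) in *.
set (r1 := minus _ _) in H1; set (r2 := minus _ _) in H2.
(* The terms [t^2 b] and [(i t)^2 b] cancel in [r1 + r2]. *)
assert (E : g p = scal (Cinv (RtoC 4) : C_AbsRing)
  (minus (plus (plus g1 g2) (plus g3 g4)) (plus r1 r2))).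
{ unfold r1, r2; module_coefs; cbn; apply injective_projections;
    simpl; field. }
assert (Hn : norm (g p) <= / 4 * (norm g1 + norm g2 + norm g3 + norm g4
  + 2 * (e * t ^ 2))).
{ rewrite E at 1.
  eapply Rle_trans; [apply norm_scal_Cmod|].
  rewrite <- RtoC_inv, Cmod_R, Rabs_pos_eq by lra.
  apply Rmult_le_compat_l; [lra|].
  apply Rle_trans with
    ((norm g1 + norm g2) + (norm g3 + norm g4) + (norm r1 + norm r2)).
  { eapply Rle_trans; [apply norm_minus_le|]; apply Rplus_le_compat;
      [eapply Rle_trans; [apply norm_triangle|]; apply Rplus_le_compat|];
      apply norm_triangle. }
  lra. }
destruct p as [p1 p2], c as [c1 c2]; simpl in M1, M2, M3, M4.
assert (Ht2 : 0 < e * t ^ 2).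
{ apply Rmult_lt_0_compat; [exact He | apply pow_lt; unfold t; lra]. }
nra.
Qed.

(** The perturbed norm attains its maximum over the disc, necessarily on the circle, where it is at
    most [M + e * r^2]; then [e] tends to 0. *)
Lemma max_modulus (g : C -> B) (c : C) (r M : R) :
  0 <= r ->
  (forall z, Cmod (Cminus z c) <= r -> exists a, deriv_at g z a) ->
  (forall z, Cmod (Cminus z c) < r -> exists b, second_diff_at g z b) ->
  (forall z, Cmod (Cminus z c) = r -> norm (g z) <= M) ->
  forall z, Cmod (Cminus z c) <= r -> norm (g z) <= M.
Proof.
intros Hr Hderiv Hdiff2 HM z Hz.
apply le_epsilon; intros e0 He0.
(* Ensures [e * r^2 <= e0], also when [r = 0]. *)
set (e := e0 / (r ^ 2 + 1)).
assert (Hr2 : 0 <= r ^ 2) by now apply pow_le.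
assert (He : 0 < e) by (apply Rdiv_lt_0_compat; lra).
destruct (disc_max c r (fun w => norm (g w) + e * Cmod (Cminus w c) ^ 2))
  as [p [Hp Hmax]]; [exact Hr| |].
{ intros w Hw eps Heps.
  destruct (Hderiv w Hw) as [a Ha].
  destruct (deriv_at_continuous g w a Ha (eps / 2)) as [d [Hd Hgd]]; [lra|].
  (* A Lipschitz constant for the quadratic term: [|v - c| + |w - c| <= 2 * r + 1] once
     [|v - w| < 1]. *)
  set (m := e * (2 * r + 1)).
  assert (Hm : 0 < m) by (apply Rmult_lt_0_compat; lra).
  assert (Hem : 0 < eps / 2 / m) by (apply Rdiv_lt_0_compat; lra).
  exists (Rmin d (Rmin 1 (eps / 2 / m))); split.
  { repeat apply Rmin_glb_lt; lra. }
  intros v Hv.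
  assert (Hv1 := Rlt_le_trans _ _ _ Hv (Rmin_l _ _)).
  assert (Hv' := Rlt_le_trans _ _ _ Hv (Rmin_r _ _)).
  assert (Hv2 := Rlt_le_trans _ _ _ Hv' (Rmin_l _ _)).
  assert (Hv3 := Rlt_le_trans _ _ _ Hv' (Rmin_r _ _)).
  assert (A1 := Rle_trans _ _ _ (norm_triangle_inv (g v) (g w)) (Hgd v Hv1)).
  assert (A2 := Cmod_triangle (Cminus v w) (Cminus w c)).
  replace (Cplus (Cminus v w) (Cminus w c)) with (Cminus v c) in A2 by ring.
  assert (A3 := Cmod_triangle (Cminus w v) (Cminus v c)).
  replace (Cplus (Cminus w v) (Cminus v c)) with (Cminus w c) in A3 by ring.
  rewrite (Cmod_minus_sym w v) in A3.
  assert (B1 := Cmod_ge_0 (Cminus v w)).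
  assert (B2 := Cmod_ge_0 (Cminus v c)).
  assert (B3 := Cmod_ge_0 (Cminus w c)).
  set (x := Cmod (Cminus v w)) in *.
  set (y := Cmod (Cminus v c)) in *.
  set (s := Cmod (Cminus w c)) in *.
  assert (A4 : m * x < eps / 2).
  { apply Rlt_le_trans with (m * (eps / 2 / m)).
    - now apply Rmult_lt_compat_l.
    - right; field; lra. }
  assert (A5 : Rabs (y ^ 2 - s ^ 2) <= (2 * r + 1) * x).
  { replace (y ^ 2 - s ^ 2) with ((y + s) * (y - s)) by ring.
    rewrite Rabs_mult, Rabs_pos_eq by lra.
    apply Rmult_le_compat; try apply Rabs_pos; try lra.
    apply Rabs_le; lra. }
  assert (A6 : e * Rabs (y ^ 2 - s ^ 2) <= eps / 2).
  { apply Rle_trans with (m * x); [|lra].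
    unfold m; rewrite Rmult_assoc; apply Rmult_le_compat_l; lra. }
  replace (norm (g v) + e * y ^ 2 - (norm (g w) + e * s ^ 2)) with
    ((norm (g v) - norm (g w)) + e * (y ^ 2 - s ^ 2)) by ring.
  eapply Rle_trans; [apply Rabs_triang|].
  rewrite (Rabs_mult e), (Rabs_pos_eq e) by lra; lra. }
assert (Hpr : Cmod (Cminus p c) = r).
{ apply Rle_antisym; [exact Hp|]; apply Rnot_lt_le; intros Hlt.
  destruct (Hdiff2 p Hlt) as [b Hb].
  destruct (no_interior_max g c p b e (r - Cmod (Cminus p c)))
    as [q [Hq Hq']]; [lra | lra | exact Hb |].
  assert (Hqc : Cmod (Cminus q c) <= r).
  { replace (Cminus q c) with (Cplus (Cminus q p) (Cminus p c)) by ring.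
    eapply Rle_trans; [apply Cmod_triangle | lra]. }
  generalize (Hmax q Hqc); lra. }
assert (A := Hmax z Hz); simpl in A; rewrite Hpr in A.
assert (B1 := HM p Hpr).
assert (B2 : 0 <= e * (Cmod (Cminus z c) * (Cmod (Cminus z c) * 1))).
{ apply Rmult_le_pos; [lra|].
  apply (pow_le _ 2), Cmod_ge_0. }
assert (B3 : e * (r * (r * 1)) <= e0).
{ apply Rle_trans with (e * (r ^ 2 + 1)).
  - apply Rmult_le_compat_l; [lra|]; simpl; lra.
  - right; unfold e; field; simpl in *; lra. }
lra.
Qed.

(** * Division by [w - c] and propagation of zeros *)

Lemma Cmod_pos_of_neq (z c : C) : z <> c -> 0 < Cmod (Cminus z c).
Proof.
intros H; apply Cmod_gt_0; intros E; apply H.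
replace z with (Cplus (Cminus z c) c) by ring; rewrite E; ring.
Qed.

Lemma little_o_scal_const (n : nat) (v : C) (p : C -> B) :
  little_o n p -> little_o n (fun k => scal (v : C_AbsRing) (p k)).
Proof.
intros Hp; apply (little_o_dom n 0 p _ (Cmod v) 1); [lra | | exact Hp].
intros k _; rewrite pow_O, Rmult_1_r; apply norm_scal_Cmod.
Qed.

Lemma little_o_scal_arg (n : nat) (p : C -> B) :
  little_o n p -> little_o (S n) (fun k => scal (k : C_AbsRing) (p k)).
Proof.
intros Hp; apply (little_o_dom n 1 p _ 1 1); [lra | | exact Hp].
intros k _; rewrite pow_1, Rmult_1_l; apply norm_scal_Cmod.
Qed.

Lemma little_o_square (x : B) :
  little_o 1 (fun k => scal (Cmult k k : C_AbsRing) x).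
Proof.
intros e He.
assert (Hx : 0 < norm x + 1) by (generalize (norm_ge_0 x); lra).
exists (e / (norm x + 1)); split; [now apply Rdiv_lt_0_compat|].
intros k Hk; eapply Rle_trans; [apply norm_scal_Cmod|].
assert (H0 := Cmod_ge_0 k).
assert (H : Cmod k * (norm x + 1) <= e).
{ apply Rle_trans with (e / (norm x + 1) * (norm x + 1)).
  - apply Rmult_le_compat_r; lra.
  - right; field; lra. }
rewrite Cmod_mult, pow_1, Rmult_assoc, Rmult_comm.
apply Rmult_le_compat_r; lra.
Qed.

(** From [f w = (w - c) g w] and [h = z - c], the second difference of [f] is [h] times that of [g]
    plus [k (g (z + k) - g (z - k))]. The last term is [2 k^2 a' + o(k^2)] by differentiability of
    [g], so the coefficient for [g] is [(b - 2 a') / h]. *)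
Lemma smooth2_at_div (f : C -> B) (z c : C) :
  z <> c -> smooth2_at f z ->
  smooth2_at (fun w => scal (Cinv (Cminus w c) : C_AbsRing) (f w)) z.
Proof.
intros Hzc [[a Ha] [b Hb]].
set (g := fun w => scal (Cinv (Cminus w c) : C_AbsRing) (f w)).
set (h := Cminus z c).
assert (Hh : h <> RtoC 0) by (apply Cmod_gt_0, Cmod_pos_of_neq; exact Hzc).
assert (Hpos : 0 < Cmod h / 2) by (apply Cmod_gt_0 in Hh; lra).
assert (Hne : forall k, Cmod k < Cmod h / 2 -> Cmod h / 2 < Cmod (Cplus h k)).
{ intros k Hk.
  generalize (Cmod_triangle (Cplus h k) (Copp k)); rewrite Cmod_opp.
  replace (Cplus (Cplus h k) (Copp k)) with h by ring; lra. }
assert (Hne0 : forall k, Cmod k < Cmod h / 2 -> Cplus h k <> RtoC 0).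
{ intros k Hk; apply Cmod_gt_0; generalize (Hne k Hk); lra. }
assert (Eg : forall k, Cmod k < Cmod h / 2 ->
  g (Cplus z k) = scal (Cinv (Cplus h k) : C_AbsRing) (f (Cplus z k))).
{ intros k _; unfold g, h; do 2 f_equal; ring. }
(* The derivative given by the quotient rule. *)
set (a' := scal (Cinv h : C_AbsRing) (minus a (scal (Cinv h : C_AbsRing) (f z)))).
assert (Hd : deriv_at g z a').
(* As [h a' + g z = a], multiplying the remainder of [g] by [h + k] gives the remainder of [f] minus
   [k^2 a']. For [|k| < |h| / 2] the factor [1 / (h + k)] is bounded by [2 / |h|]. *)
{ set (q := fun k => plus
    (minus (minus (f (Cplus z k)) (f z)) (scal (k : C_AbsRing) a))
    (scal (Cmult k k : C_AbsRing) (opp a'))).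
  apply (little_o_ext_near _
    (fun k => scal (Cinv (Cplus h k) : C_AbsRing) (q k)) _ (Cmod h / 2));
    [exact Hpos | |].
  - intros k Hk; rewrite (Eg k Hk); unfold g, q, a'; fold h.
    assert (Hk' := Hne0 k Hk).
    module_coefs; cbn; field; auto.
  - apply (little_o_dom 1 0 q _ (2 / Cmod h) (Cmod h / 2)); [exact Hpos | |].
    + intros k Hk; eapply Rle_trans; [apply norm_scal_Cmod|].
      apply Rmult_le_compat_r; [apply norm_ge_0|].
      rewrite Cmod_inv by now apply Hne0.
      rewrite pow_O, Rmult_1_r.
      replace (2 / Cmod h) with (/ (Cmod h / 2)) by (field; lra).
      apply Rinv_le_contravar; [exact Hpos | left; now apply Hne].
    + apply little_o_plus; [exact Ha | apply little_o_square]. }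
split; [now exists a'|].
exists (scal (Cinv h : C_AbsRing) (minus b (plus a' a'))).
set (r := fun k =>
  minus (minus (g (Cplus z k)) (g z)) (scal (k : C_AbsRing) a')).
assert (Hr : little_o 2 (fun k => scal (k : C_AbsRing)
  (plus (scal (Copp (RtoC 1) : C_AbsRing) (r k)) (r (Copp k))))).
{ apply little_o_scal_arg, little_o_plus.
  - apply little_o_scal_const; exact Hd.
  - apply little_o_opp_arg; exact Hd. }
apply (little_o_ext_near _ _ _ (Cmod h / 2) Hpos) with
  (2 := little_o_scal_const _ (Cinv h) _ (little_o_plus _ _ _ Hb Hr)).
intros k Hk.
assert (Hk2 : Cmod (Copp k) < Cmod h / 2) by now rewrite Cmod_opp.
assert (Ef : forall k, Cmod k < Cmod h / 2 ->
  f (Cplus z k) = scal (Cplus h k : C_AbsRing) (g (Cplus z k))).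
{ intros j Hj; rewrite (Eg j Hj).
  assert (Hj' := Hne0 j Hj); module_coefs; cbn; field; auto. }
assert (Ef0 : f z = scal (h : C_AbsRing) (g z)).
{ unfold g; fold h; module_coefs; cbn; field; auto. }
unfold Cminus in h |- *; cbv beta.
rewrite (Ef k Hk), (Ef (Copp k) Hk2), Ef0; unfold r.
fold (g (Cplus z k)) (g (Cplus z (Copp k))) (g z).
set (g1 := g (Cplus z k)); set (g2 := g (Cplus z (Copp k))); set (g0 := g z).
clearbody a' g1 g2 g0.
module_coefs; cbn; field; auto.
Qed.

(** Covers the centre of the disc below, where [w - c] is not invertible but the quotients vanish
    nearby. *)
Lemma smooth2_at_near_zero (f : C -> B) (z : C) (d : R) :
  0 < d -> (forall w, Cmod (Cminus w z) < d -> f w = zero) -> smooth2_at f z.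
Proof.
intros Hd H.
assert (H0 : f z = zero).
{ apply H; replace (Cminus z z) with (RtoC 0) by ring; now rewrite Cmod_0. }
assert (H1 : forall k, Cmod k < d -> f (Cplus z k) = zero).
{ intros k Hk; apply H; now replace (Cminus (Cplus z k) z) with k by ring. }
assert (H2 : forall k, Cmod k < d -> f (Cminus z k) = zero).
{ intros k Hk; apply H1; now rewrite Cmod_opp. }
assert (Hz : forall n, little_o n (fun _ => zero : B)).
{ intros n e He; exists 1; split; [lra|]; intros k _; rewrite norm_zero.
  apply Rmult_le_pos; [lra | apply pow_le, Cmod_ge_0]. }
split; exists zero;
  apply (little_o_ext_near _ (fun _ => zero) _ d Hd); try apply Hz;
  intros k Hk; rewrite ?(H1 k Hk), ?(H2 k Hk), ?H0; module_ring.
Qed.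

(* A Schwarz-type estimate: [f w / (w - c)^n] is still holomorphic, so the
   maximum principle gives [norm (f z) <= M (|z - c| / R)^n] for every [n]. *)
Lemma zero_on_disc (f : C -> B) (c : C) (r R : R) :
  0 < r ->
  (forall z, Cmod (Cminus z c) <= R -> smooth2_at f z) ->
  (forall z, Cmod (Cminus z c) < r -> f z = zero) ->
  forall z, Cmod (Cminus z c) < R -> f z = zero.
Proof.
intros Hr Hf H0 z Hz.
assert (HR : 0 < R) by (generalize (Cmod_ge_0 (Cminus z c)); lra).
set (g := fix g (n : nat) : C -> B := match n with
  | O => f
  | S n => fun w => scal (Cinv (Cminus w c) : C_AbsRing) (g n w) end).
(* This includes [w = c]: whatever value [Cinv] takes at 0, it multiplies [zero]. *)
assert (Hg0 : forall n w, Cmod (Cminus w c) < r -> g n w = zero).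
{ induction n as [|n IH]; intros w Hw; [now apply H0|]; simpl.
  rewrite IH by exact Hw; module_ring. }
assert (Hg : forall n w, Cmod (Cminus w c) <= R -> smooth2_at (g n) w).
{ induction n as [|n IH]; intros w Hw; [now apply Hf|].
  destruct (classic (w = c)) as [-> | Hwc].
  - now apply smooth2_at_near_zero with r, Hg0.
  - apply smooth2_at_div; [exact Hwc | now apply IH]. }
destruct (disc_max c R (fun w => norm (f w))) as [p [_ Hp]]; [lra| |].
{ intros w Hw e He; destruct (Hf w Hw) as [[a Ha] _].
  destruct (deriv_at_continuous f w a Ha e He) as [d [Hd Hgd]].
  exists d; split; [exact Hd|]; intros v Hv.
  eapply Rle_trans; [apply norm_triangle_inv | now apply Hgd]. }
set (M := norm (f p)) in Hp.
(* One [M] serves for every [n]: on the circle each division contributes exactly a factor [/ R]. *)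
assert (HM : forall n w, Cmod (Cminus w c) = R -> norm (g n w) <= M * (/ R) ^ n).
{ induction n as [|n IH]; intros w Hw; simpl.
  - rewrite Rmult_1_r; apply Hp; lra.
  - eapply Rle_trans; [apply norm_scal_Cmod|].
    rewrite Cmod_inv by (apply Cmod_gt_0; lra); rewrite Hw.
    replace (M * (/ R * (/ R) ^ n)) with (/ R * (M * (/ R) ^ n)) by ring.
    apply Rmult_le_compat_l; [left; now apply Rinv_0_lt_compat | now apply IH]. }
assert (Hgz : forall n, norm (g n z) <= M * (/ R) ^ n).
{ intros n; apply (max_modulus (g n) c R); try lra.
  - intros w Hw; apply (Hg n w Hw).
  - intros w Hw; apply (Hg n w); lra.
  - apply HM. }
destruct (classic (z = c)) as [-> | Hzc].
{ apply H0; replace (Cminus c c) with (RtoC 0) by ring; now rewrite Cmod_0. }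
assert (Hfg : forall n, norm (f z) <= Cmod (Cminus z c) ^ n * norm (g n z)).
{ induction n as [|n IH]; simpl; [lra|].
  eapply Rle_trans; [exact IH|].
  rewrite (Rmult_comm (Cmod _)), Rmult_assoc.
  apply Rmult_le_compat_l; [apply pow_le, Cmod_ge_0|].
  eapply Rle_trans; [|apply norm_scal_Cmod]; right; f_equal.
  assert (Hne : Cminus z c <> RtoC 0) by now apply Cmod_gt_0, Cmod_pos_of_neq.
  set (y := g n z); module_coefs; cbn; field; exact Hne. }
set (x := Cmod (Cminus z c) * / R).
assert (Hx : 0 <= x < 1).
{ split; unfold x.
  - apply Rmult_le_pos; [apply Cmod_ge_0 | left; now apply Rinv_0_lt_compat].
  - apply Rmult_lt_reg_r with R; [exact HR|].
    rewrite Rmult_assoc, Rinv_l by lra; lra. }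
apply norm_eq_zero, Rle_antisym; [|apply norm_ge_0].
(* The constant sequence [norm (f z)] is dominated by a geometric sequence of ratio [x < 1]. *)
apply (is_lim_seq_le (fun _ => norm (f z)) (fun n => M * x ^ n)
  (norm (f z)) 0).
- intros n; eapply Rle_trans; [apply (Hfg n)|].
  unfold x; rewrite Rpow_mult_distr.
  replace (M * (Cmod (Cminus z c) ^ n * (/ R) ^ n)) with
    (Cmod (Cminus z c) ^ n * (M * (/ R) ^ n)) by ring.
  apply Rmult_le_compat_l; [apply pow_le, Cmod_ge_0 | apply Hgz].
- apply is_lim_seq_const.
- replace (Finite 0) with (Rbar_mult M 0) by (simpl; f_equal; ring).
  apply is_lim_seq_scal_l, is_lim_seq_geom; rewrite Rabs_pos_eq; lra.
Qed.

End SecondOrder.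

(** * Geometry of the sector *)

(** If [chi] lies outside []-PI, PI]], a shift by [2 * PI] gives the principal value. In that case
    [theta > PI], so the shifted angle meets the bound as well. *)
Lemma sector_polar (theta m chi : R) :
  0 < m -> Rabs chi < theta -> - (2 * PI) < chi < 2 * PI ->
  sector theta (m * cos chi, m * sin chi).
Proof.
intros Hm Hth Hchi.
assert (Hmod : Cmod (m * cos chi, m * sin chi) = m).
{ unfold Cmod; simpl.
  replace (_ + _) with (m ^ 2 * (Rsqr (sin chi) + Rsqr (cos chi)))
    by (unfold Rsqr; ring).
  rewrite sin2_cos2, Rmult_1_r; apply sqrt_pow2; lra. }
split; [apply Cmod_gt_0; lra|].
apply Rabs_lt_between in Hth.
unfold is_arg; rewrite Hmod.
destruct (Rle_lt_dec chi (- PI)) as [H1 | H1];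
  [| destruct (Rle_lt_dec chi PI) as [H2 | H2]].
- exists (chi + 2 * PI); rewrite cos_plus, sin_plus, cos_2PI, sin_2PI.
  repeat split; try lra; [f_equal; ring | apply Rabs_def1; lra].
- exists chi; repeat split; try lra; apply Rabs_def1; lra.
- exists (chi - 2 * PI); rewrite cos_minus, sin_minus, cos_2PI, sin_2PI.
  repeat split; try lra; [f_equal; ring | apply Rabs_def1; lra].
Qed.

(** The sector is an open cone, so the relative radius [a] does not depend on [t]. With
    [z = t z0 (1 + w)] and [|w| <= a], the argument moves by [atan (w2 / (1 + w1))], which stays
    within the angular gap [theta - |phi|]. *)
Lemma sector_cone (theta : R) (z0 : C) :
  sector theta z0 -> exists a, 0 < a < 1 /\
    forall t z, 0 < t -> Cmod (Cminus z (Cmult (RtoC t) z0)) <= a * (t * Cmod z0) ->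
      sector theta z.
Proof.
intros [Hz0 [phi [[Hphi E0] Hth]]].
apply Cmod_gt_0 in Hz0.
assert (HPI := PI2_1).
(* The cap 1 keeps [eta] below [PI / 2], where [tan] is positive and inverted by [atan]. *)
set (eta := Rmin 1 (theta - Rabs phi)).
assert (Heta : 0 < eta) by (apply Rmin_glb_lt; lra).
assert (Heta1 : eta <= 1) by apply Rmin_l.
assert (Heta2 : eta <= theta - Rabs phi) by apply Rmin_r.
assert (Htan : 0 < tan eta) by (apply tan_gt_0; lra).
(* The quarter gives [1 + w1 >= 3 / 4] and [|w2| <= tan eta / 4], hence
   [|w2 / (1 + w1)| < tan eta]. *)
set (a := Rmin 1 (tan eta) / 4).
assert (Hmin : 0 < Rmin 1 (tan eta)) by (apply Rmin_glb_lt; lra).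
assert (Ha1 := Rmin_l 1 (tan eta)); assert (Ha2 := Rmin_r 1 (tan eta)).
exists a; split; [unfold a; lra|].
intros t z Ht Hz.
set (rho := t * Cmod z0) in *.
assert (Hrho : 0 < rho) by now apply Rmult_lt_0_compat.
assert (Htz : Cmult (RtoC t) z0 <> RtoC 0).
{ apply Cmod_gt_0; rewrite Cmod_mult, Cmod_R, Rabs_pos_eq; [exact Hrho | lra]. }
set (w := Cdiv (Cminus z (Cmult (RtoC t) z0)) (Cmult (RtoC t) z0)).
assert (Hw : Cmod w <= a).
{ unfold w; rewrite Cmod_div by exact Htz.
  rewrite (Cmod_mult (RtoC t)), Cmod_R, (Rabs_pos_eq t) by lra; fold rho.
  apply Rmult_le_reg_r with rho; [exact Hrho|].
  unfold Rdiv; rewrite Rmult_assoc, Rinv_l by lra; lra. }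
assert (Ez : z = Cmult (Cmult (RtoC t) z0) (Cplus (RtoC 1) w))
  by (unfold w; field; split; intros E; apply Htz; rewrite E; ring).
assert (Hr := Rle_trans _ _ _ (Rmax_Cmod w) Hw).
assert (Hr1 := Rle_trans _ _ _ (Rmax_l _ _) Hr).
assert (Hr2 := Rle_trans _ _ _ (Rmax_r _ _) Hr).
clearbody w; destruct w as [w1 w2]; simpl in Hr1, Hr2.
apply Rabs_le_between in Hr1; apply Rabs_le_between in Hr2.
assert (Hp : 3 / 4 <= 1 + w1) by (unfold a in Hr1; lra).
set (y := w2 / (1 + w1)).
assert (Ey : w2 = (1 + w1) * y) by (unfold y; field; lra).
assert (Hy : - tan eta < y < tan eta).
{ unfold a in Hr2; split; apply Rmult_lt_reg_l with (1 + w1); nra. }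
assert (Hpsi : - eta < atan y < eta).
{ split.
  - rewrite <- (atan_tan eta), <- atan_opp by lra.
    apply atan_increasing; lra.
  - rewrite <- (atan_tan eta) by lra; apply atan_increasing; lra. }
set (psi := atan y) in *.
set (n := sqrt (1 + Rsqr y)).
assert (Hn : 0 < n) by (apply sqrt_lt_R0; generalize (Rle_0_sqr y); lra).
assert (Hc : cos psi * n = 1)
  by (unfold psi; rewrite cos_atan; fold n; field; lra).
assert (Hs : sin psi * n = y)
  by (unfold psi; rewrite sin_atan; fold n; field; lra).
replace z with ((rho * (1 + w1) * n * cos (phi + psi),
  rho * (1 + w1) * n * sin (phi + psi)) : C).
- assert (HA : Rabs (phi + psi) < theta).
  { eapply Rle_lt_trans; [apply Rabs_triang|].
    assert (Rabs psi < eta) by (apply Rabs_def1; lra); lra. }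
  apply sector_polar; [| exact HA | lra].
  repeat apply Rmult_lt_0_compat; lra.
- rewrite Ez, E0, cos_plus, sin_plus; unfold Cmult, Cplus, RtoC; simpl.
  unfold rho; rewrite Ey, <- Hs; f_equal.
  + transitivity (t * Cmod z0 * (1 + w1) *
      (cos phi * (cos psi * n) - sin phi * (sin psi * n))); [ring|].
    rewrite Hc; ring.
  + transitivity (t * Cmod z0 * (1 + w1) *
      (sin phi * (cos psi * n) + cos phi * (sin psi * n))); [ring|].
    rewrite Hc; ring.
Qed.

(** * Orbits of the analytic semigroup *)

Lemma is_derive_deriv_at {V : NormedModule C_AbsRing} (g : C_AbsRing -> V)
    (z : C_AbsRing) (l : V) :
  is_derive g z l -> deriv_at g z l.
Proof.
intros [_ H] e He.
destruct (H z (fun P HP => HP) (mkposreal e He)) as [d Hd].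
exists d; split; [apply cond_pos|].
intros k Hk; rewrite pow_1.
assert (E : minus (Cplus z k : C_AbsRing) z = k).
{ change (Cplus (Cplus z k) (Copp z) = k); ring. }
assert (Hball : ball z d (Cplus z k : C_AbsRing)).
{ change (Cmod (minus (Cplus z k : C_AbsRing) z) < d); now rewrite E. }
assert (A : norm (minus (minus (g (Cplus z k)) (g z))
    (scal (minus (Cplus z k : C_AbsRing) z) l))
  <= e * Cmod (minus (Cplus z k : C_AbsRing) z)) by exact (Hd _ Hball).
rewrite E in A; exact A.
Qed.

Section AnalyticSemigroup.

Context {B : NormedModule C_AbsRing}.

Lemma op_apply_plus (S : bounded_op B) (x y : B) :
  S (plus x y) = plus (S x) (S y).
Proof. exact (linear_plus _ (op_is_linear S) x y). Qed.

Lemma op_apply_scal (S : bounded_op B) (k : C) (x : B) :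
  S (scal (k : C_AbsRing) x) = scal (k : C_AbsRing) (S x).
Proof. exact (linear_scal _ (op_is_linear S) k x). Qed.

Lemma op_apply_opp (S : bounded_op B) (x : B) : S (opp x) = opp (S x).
Proof. exact (linear_opp _ x (op_is_linear S)). Qed.

Lemma op_apply_zero (S : bounded_op B) : S zero = zero.
Proof. exact (linear_zero _ (op_is_linear S)). Qed.

(** Around [w = z / 2], each factor of [(P - W)(W - N)] is [k D + o(k)] in operator norm, which
    gives the second-order coefficient [D (D u)]. *)
Lemma analytic_semigroup_smooth2 (theta : R) (T : C_AbsRing -> bounded_op B)
    (z : C) (u : B) :
  analytic_semigroup theta T -> sector theta z ->
  smooth2_at (fun w => T w u) z.
Proof.
intros [Hder [Hmul _]] Hz.
destruct (sector_cone theta z Hz) as [a [Ha Hcone]].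
assert (Hzpos : 0 < Cmod z) by (apply Cmod_gt_0; apply Hz).
set (w := Cmult (RtoC (/ 2)) z).
set (d := a * (/ 2 * Cmod z)).
assert (Hd : 0 < d) by (unfold d; nra).
assert (Hw : forall k, Cmod k < d -> sector theta (Cplus w k)).
{ intros k Hk; apply (Hcone (/ 2)); [lra|]; fold w.
  replace (Cminus (Cplus w k) w) with k by ring; fold d; lra. }
assert (Hzk : forall k, Cmod k < d -> sector theta (Cplus z k)).
{ intros k Hk; apply (Hcone 1); [lra|].
  replace (Cminus (Cplus z k) (Cmult (RtoC 1) z)) with k by ring.
  unfold d in Hk; nra. }
assert (H0 : Cmod (RtoC 0) < d) by now rewrite Cmod_0.
assert (Hw0 : sector theta w).
{ replace w with (Cplus w (RtoC 0)) by ring; now apply Hw. }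
assert (E2 : Cplus w w = z).
{ unfold w; apply injective_projections; simpl; field. }
destruct (Hder z Hz) as [Dz HDz]; apply is_derive_deriv_at in HDz.
destruct (Hder w Hw0) as [D HD]; apply is_derive_deriv_at in HD.
assert (Happ : forall (p : C -> bounded_op B) (n : nat),
  little_o n p -> little_o n (fun k => p k u)).
{ intros p n Hp; apply (little_o_dom n 0 p _ (norm u) 1); [lra | | exact Hp].
  intros k _; rewrite pow_O, Rmult_1_r, Rmult_comm; apply op_norm_apply. }
split.
{ exists (Dz u); exact (Happ _ _ HDz). }
exists (D (D u)).
set (p := fun k : C => minus (minus (T (Cplus w k)) (T w)) (scal (k : C_AbsRing) D)).
assert (Hp : little_o 1 p) by exact HD.
assert (Hpu := little_o_opp_arg _ _ (Happ _ _ Hp)); cbv beta in Hpu.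
set (y := fun k : C => minus (T w u) (T (Cplus w (Copp k)) u)).
assert (Ey : forall k, y k = minus (scal (k : C_AbsRing) (D u)) (p (Copp k) u)).
{ intros k; unfold y.
  change (p (Copp k) u) with
    (minus (minus (T (Cplus w (Copp k)) u) (T w u))
      (scal (Copp k : C_AbsRing) (D u))).
  module_ring. }
(* Smallness of [p k] in operator norm allows the moving argument [y k], which is [O(k)]. *)
assert (Hpy : little_o 2 (fun k => p k (y k))).
{ destruct (Hpu 1 Rlt_0_1) as [d1 [Hd1 H1]].
  apply (little_o_dom 1 1 p _ (norm (D u) + 1) d1 Hd1); [|exact Hp].
  intros k Hk; eapply Rle_trans; [apply op_norm_apply|].
  change (op_norm (p k)) with (norm (p k)).
  rewrite Rmult_comm; apply Rmult_le_compat_r; [apply norm_ge_0|].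
  rewrite Ey; eapply Rle_trans; [apply norm_minus_le|].
  assert (A1 := norm_scal_Cmod k (D u)).
  assert (A2 := H1 k Hk).
  apply Rle_trans with (Cmod k * norm (D u) + 1 * Cmod k ^ 1).
  - apply Rplus_le_compat; assumption.
  - right; ring. }
assert (HDp : little_o 1 (fun k => D (p (Copp k) u))).
{ apply (little_o_dom 1 0 _ _ (op_norm D) 1 Rlt_0_1) with (2 := Hpu).
  intros k _; rewrite pow_O, Rmult_1_r; apply op_norm_apply. }
(* The total remainder is [p k (y k) - k D (p (-k) u)]: expand [P - W] first, then [D (y k)]. *)
apply (little_o_ext_near _ _ _ d Hd) with (2 := little_o_plus _ _ _ Hpy
  (little_o_scal_const _ (Copp (RtoC 1)) _ (little_o_scal_arg _ _ HDp))).
intros k Hk.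
assert (Hk' : Cmod (Copp k) < d) by now rewrite Cmod_opp.
assert (Epl : T (Cplus z k) u = T (Cplus w k) (T w u)).
{ assert (Hs := Hzk k Hk).
  replace (Cplus z k) with (Cplus (Cplus w k) w) in Hs |- * by (rewrite <- E2; ring).
  rewrite Hmul; auto. }
assert (Emi : T (Cminus z k) u = T w (T (Cplus w (Copp k)) u)).
{ assert (Hs := Hzk (Copp k) Hk').
  replace (Cplus z (Copp k)) with (Cplus w (Cplus w (Copp k))) in Hs
    by (rewrite <- E2; ring).
  replace (Cminus z k) with (Cplus w (Cplus w (Copp k))) by (rewrite <- E2; ring).
  rewrite Hmul; auto. }
assert (Ez1 : T z u = T w (T w u)).
{ assert (Hs := Hz); rewrite <- E2 in Hs |- *; rewrite Hmul; auto. }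
(* Of the two copies of [T z u] in the second difference, one is read as [W W u] and the other as
   [P N u]; this makes it factor. *)
assert (Ez2 : T z u = T (Cplus w k) (T (Cplus w (Copp k)) u)).
{ assert (Hs := Hz).
  replace z with (Cplus (Cplus w k) (Cplus w (Copp k))) in Hs |- *
    by (rewrite <- E2; ring).
  rewrite Hmul; auto. }
rewrite Epl, Emi.
replace (plus (T z u) (T z u)) with
  (plus (T w (T w u)) (T (Cplus w k) (T (Cplus w (Copp k)) u)))
  by (rewrite <- Ez1, <- Ez2; reflexivity).
assert (EDy : D (y k) =
  minus (scal (k : C_AbsRing) (D (D u))) (D (p (Copp k) u))).
{ rewrite Ey; unfold minus.
  rewrite op_apply_plus, op_apply_scal, op_apply_opp; reflexivity. }
change (p k (y k)) with
  (minus (minus (T (Cplus w k) (y k)) (T w (y k))) (scal (k : C_AbsRing) (D (y k)))).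
rewrite EDy; unfold y, minus.
rewrite !op_apply_plus, !op_apply_opp.
module_ring.
Qed.

(** The disc of radius [a |c|] about [c = (1 + a / 2) t z0] lies in the sector. Near [c], points are
    [t z0] plus a sector point close to [(a / 2) t z0], so the orbit vanishes there. The target is
    at distance [a t |z0|] from [c], less than [a |c|], and its ratio [1 - a / 2] to [t z0] is
    independent of [t]. *)
Lemma analytic_semigroup_kernel_ray (theta a : R) (T : C_AbsRing -> bounded_op B)
    (z0 : C) (u : B) :
  analytic_semigroup theta T -> 0 < a < 1 -> sector theta z0 ->
  (forall t z, 0 < t -> Cmod (Cminus z (Cmult (RtoC t) z0)) <= a * (t * Cmod z0) ->
    sector theta z) ->
  forall t, 0 < t -> T (Cmult (RtoC t) z0) u = zero ->
    T (Cmult (RtoC ((1 - a / 2) * t)) z0) u = zero.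
Proof.
intros HT Ha Hz0 Hcone t Ht Hzero.
assert (Hz0pos : 0 < Cmod z0) by (apply Cmod_gt_0; apply Hz0).
set (c := Cmult (RtoC ((1 + a / 2) * t)) z0).
assert (Htz : 0 < t * Cmod z0) by now apply Rmult_lt_0_compat.
assert (Hc : forall z, Cmod (Cminus z c) <= a * ((1 + a / 2) * t * Cmod z0) ->
  sector theta z).
{ intros z Hz; apply (Hcone ((1 + a / 2) * t)); [nra | exact Hz]. }
apply (zero_on_disc (fun z => T z u) c (a * (a / 2 * t * Cmod z0))
  (a * ((1 + a / 2) * t * Cmod z0))).
- repeat apply Rmult_lt_0_compat; lra.
- intros z Hz; apply analytic_semigroup_smooth2 with theta; auto.
- intros z Hz.
  set (w := Cminus z (Cmult (RtoC t) z0)).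
  assert (Hw : sector theta w).
  { apply (Hcone (a / 2 * t)); [nra|].
    replace (Cminus w (Cmult (RtoC (a / 2 * t)) z0)) with (Cminus z c); [lra|].
    unfold w, c; rewrite !RtoC_mult, RtoC_plus; ring. }
  assert (Hz' : sector theta z) by (apply Hc; nra).
  assert (Htz0 : sector theta (Cmult (RtoC t) z0)).
  { apply (Hcone t); [exact Ht|].
    replace (Cminus _ _) with (RtoC 0) by ring; rewrite Cmod_0; nra. }
  assert (Ez : z = Cplus w (Cmult (RtoC t) z0)) by (unfold w; ring).
  rewrite Ez in Hz' |- *.
  destruct HT as [_ [Hmul _]]; rewrite Hmul by assumption; simpl.
  rewrite Hzero; apply op_apply_zero.
- replace (Cminus _ c) with (Cmult (RtoC (- (a * t))) z0).
  + rewrite Cmod_mult, Cmod_R, Rabs_Ropp, Rabs_pos_eq by nra.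
    assert (0 < a * (a / 2 * t * Cmod z0))
      by (repeat apply Rmult_lt_0_compat; lra).
    lra.
  + unfold c; transitivity
      (Cmult (Cminus (RtoC ((1 - a / 2) * t)) (RtoC ((1 + a / 2) * t))) z0);
      [|ring].
    f_equal; rewrite <- RtoC_minus; f_equal; field.
Qed.

Lemma analytic_semigroup_kernel (theta : R) (T : C_AbsRing -> bounded_op B)
    (z0 : C) (u : B) :
  analytic_semigroup theta T -> sector theta z0 -> T z0 u = zero -> u = zero.
Proof.
intros HT Hz0 Hzero.
destruct (sector_cone theta z0 Hz0) as [a [Ha Hcone]].
assert (Hz0pos : 0 < Cmod z0) by (apply Cmod_gt_0; apply Hz0).
set (q := 1 - a / 2).
assert (Hq : 0 < q < 1) by (unfold q; lra).
assert (Hqn : forall n, T (Cmult (RtoC (q ^ n)) z0) u = zero).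
{ induction n as [|n IH]; simpl.
  - rewrite Cmult_1_l; exact Hzero.
  - apply analytic_semigroup_kernel_ray with theta; auto; apply pow_lt; lra. }
assert (Hcont := proj2 (proj2 (proj2 HT)) u).
apply norm_eq_zero, Rle_antisym; [|apply norm_ge_0].
apply le_epsilon; intros e He; rewrite Rplus_0_l.
destruct (Hcont _ (locally_ball_norm u (mkposreal e He))) as [d Hd].
assert (HRq : Rabs q < 1) by (apply Rabs_def1; lra).
(* Takes [n] so large that [q^n z0] enters the ball where the orbit is within [e] of [u]; as the
   orbit is [zero] there, [norm u < e]. *)
destruct (pow_lt_1_zero q HRq (d / Cmod z0))
  as [n Hn]; [apply Rdiv_lt_0_compat; [apply cond_pos | exact Hz0pos]|].
specialize (Hn n (le_n n)).
assert (Hpos := pow_lt q n (proj1 Hq)).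
rewrite Rabs_pos_eq in Hn by lra.
assert (A : ball_norm u e (T (Cmult (RtoC (q ^ n)) z0) u)).
{ apply Hd.
  - change (Cmod (Cminus (Cmult (RtoC (q ^ n)) z0) (RtoC 0)) < d).
    replace (Cminus _ _) with (Cmult (RtoC (q ^ n)) z0) by ring.
    rewrite Cmod_mult, Cmod_R, Rabs_pos_eq by lra.
    apply (Rmult_lt_compat_r (Cmod z0)) in Hn; [|exact Hz0pos].
    replace (d / Cmod z0 * Cmod z0) with (d : R) in Hn by (field; lra); exact Hn.
  - apply (Hcone (q ^ n)); [exact Hpos|].
    replace (Cminus _ _) with (RtoC 0) by ring; rewrite Cmod_0.
    repeat apply Rmult_le_pos; lra. }
rewrite Hqn in A; unfold ball_norm in A.
rewrite <- (norm_opp u); replace (opp u) with (minus zero u) by module_ring.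
left; exact A.
Qed.

Lemma analytic_semigroup_injective (theta : R) (T : C_AbsRing -> bounded_op B)
    (z : C) :
  analytic_semigroup theta T -> sector theta z ->
  forall x y : B, T z x = T z y -> x = y.
Proof.
intros HT Hz x y Hxy.
assert (H0 : minus x y = zero).
{ apply (analytic_semigroup_kernel theta T z); [exact HT | exact Hz |].
  unfold minus; rewrite op_apply_plus, op_apply_opp, Hxy; module_ring. }
transitivity (plus (minus x y) y); [module_ring|].
rewrite H0; module_ring.
Qed.

End AnalyticSemigroup.

(* [T z] is e^{zA}; its restriction to the real t >= 0 is the C_0-semigroup
   generated by A. *)
Theorem proposition1 (B : CompleteNormedModule C_AbsRing)
    (A : B -> B -> Prop) (T : C_AbsRing -> bounded_op B) (theta : R)
    (Htheta : 0 < theta)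
    (HC0 : C0_semigroup (fun t : R => T (RtoC t)))
    (HA : is_generator A (fun t : R => T (RtoC t)))
    (Hanalytic : analytic_semigroup theta T) :
  forall z : C_AbsRing, sector theta z ->
    forall x y : B, T z x = T z y -> x = y.
Proof.
intros z Hz x y; exact (analytic_semigroup_injective theta T z Hanalytic Hz x y).
Qed.
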